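(* Let $\kappa,\beta>0$, let $V:\mathbb{R}^2\to\mathbb{R}$, $V=V(p,q)$, be smooth, and let $f:\mathbb{C}\to\mathbb{C}$ be given by $\mathrm{Re}\, f(p+iq)=\frac{\partial V}{\partial p}(p,q)$, $\mathrm{Im}\, f(p+iq)=\frac{\partial V}{\partial q}(p,q)$. Then the nonparaxial nonlinear Schrödinger equation $$\kappa u_{tt}+iu_t+\beta u_{xx}+f(u)=0,\qquad u=u(x,t)\in\mathbb{C},$$ has a Hamiltonian formulation: writing $u=p+iq$ and $u_t=\phi+i\varphi$ with $p,q,\phi,\varphi$ real-valued, the equation (for smooth $u$) is equivalent to the first-order system $$\frac{\partial}{\partial t}\begin{pmatrix} p \\ q \\ \phi \\ \varphi \end{pmatrix}=\mathbb{J}(\kappa)\,\delta\mathcal{H}(p,q,\phi,\varphi),\qquad \mathbb{J}(\kappa)=\begin{pmatrix} 0&0&-\frac1\kappa&0 \\ 0&0&0&-\frac1\kappa \\ \frac1\kappa&0&0&-\frac1{\kappa^2} \\ 0&\frac1\kappa&\frac1{\kappa^2}&0 \end{pmatrix},$$ where $\mathbb{J}(\kappa)$ is a skew-symmetric matrix and the Hamiltonian is $$\mathcal{H}(p,q,\phi,\varphi)=\int_{-\infty}^{\infty}\left(\frac{\beta}{2}(p_x^2+q_x^2)-V(p,q)-\frac{\kappa}{2}(\phi^2+\varphi^2)\right)dx.$$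
   Context: For a functional $\mathcal{F}(p,q,\phi,\varphi)=\int_{-\infty}^{\infty} L(p,q,\phi,\varphi,p_x,q_x,\phi_x,\varphi_x)\,dx$, the variational derivative $\delta\mathcal{F}=\left(\frac{\delta\mathcal F}{\delta p},\frac{\delta\mathcal F}{\delta q},\frac{\delta\mathcal F}{\delta\phi},\frac{\delta\mathcal F}{\delta\varphi}\right)^T$ is given by the Euler operator applied to the density, e.g. $\frac{\delta\mathcal F}{\delta p}=\frac{\partial L}{\partial p}-\frac{\partial}{\partial x}\frac{\partial L}{\partial p_x}$, and analogously for the other variables. *)

(* Defs.v *)
From HB Require Import structures.
From mathcomp Require Import all_boot all_order all_algebra.
From mathcomp Require Import all_classical all_reals all_analysis.
From mathcomp Require Import complex.

Set Implicit Arguments.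
Unset Strict Implicit.
Unset Printing Implicit Defensive.

Import Order.TTheory GRing.Theory Num.Theory.
Import numFieldNormedType.Exports.

Local Open Scope classical_set_scope.
Local Open Scope ring_scope.

(* [Rcomplex R] is the library's copy of [R[i]] that is an R-module with the
   real-valued modulus as norm. With the metric of that norm it is a real
   normed module, so that [derive] applies to complex-valued functions of real
   variables. *)
Lemma Rcomplex_normrZ (R : realType) (l : R) (z : Rcomplex R) :
  `|l *: z| = `|l| * `|z|.
Proof.
case: z => a b; rewrite /Num.norm /= !exprMn -mulrDr sqrtrM ?sqr_ge0 //.
by rewrite sqrtr_sqr.
Qed.

HB.instance Definition _ (R : realType) := isPointed.Build (Rcomplex R) 0.
HB.instance Definition _ (R : realType) :=
  PseudoMetric.copy (Rcomplex R) (pseudoMetric_normed (Rcomplex R)).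
HB.instance Definition _ (R : realType) :=
  NormedZmod_PseudoMetric_eq.Build R (Rcomplex R) erefl.
HB.instance Definition _ (R : realType) :=
  PseudoMetricNormedZmod_Lmodule_isNormedModule.Build R (Rcomplex R)
    (@Rcomplex_normrZ R).

(* C^oo on a finite-dimensional space: every iterated directional derivative
   exists and is continuous. *)
Definition iter_derive (R : realType) (U W : normedModType R) (vs : seq U)
    (f : U -> W) : U -> W :=
  foldr (fun v g => 'D_v g) f vs.

Definition smooth (R : realType) (U W : normedModType R) (f : U -> W) : Prop :=
  forall vs : seq U,
    continuous (iter_derive vs f) /\
    forall x v, derivable (iter_derive vs f) x v.

(* Points of R * R are (x, t) for fields and (p, q) for potentials. *)
Definition partial1 (R : realType) (W : normedModType R) (f : R * R -> W)
    : R * R -> W := 'D_((1, 0) : R * R) f.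
Definition partial2 (R : realType) (W : normedModType R) (f : R * R -> W)
    : R * R -> W := 'D_((0, 1) : R * R) f.

(* A functional of n fields of one real variable with a first-order density
   [L w w_x]. It is kept together with its density because the variational
   derivative is by definition the Euler operator applied to the density, which
   makes sense whether or not the integral converges. *)
Record functional (R : realType) (n : nat) := Functional {
  density : 'cV[R]_n -> 'cV[R]_n -> R
}.

Definition field_x (R : realType) (n : nat) (w : R -> 'cV[R]_n) (x : R)
    : 'cV[R]_n :=
  \col_i derive1 (fun y => w y i 0) x.

Definition functional_value (R : realType) (n : nat) (F : functional R n)
    (w : R -> 'cV[R]_n) : R :=
  \int[lebesgue_measure]_x density F (w x) (field_x w x).

Coercion functional_value : functional >-> Funclass.

Definition variational_derivative (R : realType) (n : nat)
    (F : functional R n) (w : R -> 'cV[R]_n) (x : R) : 'cV[R]_n :=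
  \col_i ('D_(delta_mx i 0) (fun a => density F a (field_x w x)) (w x)
          - derive1 (fun y => 'D_(delta_mx i 0) (fun b => density F (w y) b)
                                (field_x w y)) x).

Definition col4 (R : realType) (a b c d : R) : 'cV[R]_4 :=
  \col_(i < 4) [:: a; b; c; d]`_i.

Definition Jmat (R : realType) (kappa : R) : 'M[R]_4 :=
  \matrix_(i < 4, j < 4)
    (nth [::]
      [:: [:: 0;            0;            - kappa^-1;       0                ];
          [:: 0;            0;            0;                - kappa^-1       ];
          [:: kappa^-1;     0;            0;                - (kappa ^+ 2)^-1];
          [:: 0;            kappa^-1;     (kappa ^+ 2)^-1;  0                ]]
      i)`_j.

(* The components of the column w are p, q, phi, varphi, in this order. *)
Definition hamiltonian (R : realType) (kappa beta : R) (V : R * R -> R)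
    : functional R 4 :=
  Functional (fun w w_x : 'cV[R]_4 =>
    beta / 2 * (w_x 0 0 ^+ 2 + w_x 1 0 ^+ 2)
    - V (w 0 0, w 1 0)
    - kappa / 2 * (w 2 0 ^+ 2 + w 3 0 ^+ 2)).

Definition solves_nnls (R : realType) (kappa beta : R)
    (f : Rcomplex R -> Rcomplex R) (u : R * R -> Rcomplex R) : Prop :=
  forall z : R * R,
    kappa *: partial2 (partial2 u) z + ('i%C : Rcomplex R) * partial2 u z
    + beta *: partial1 (partial1 u) z + f (u z) = 0.

Definition solves_hamiltonian_system (R : realType) (J : 'M[R]_4)
    (H : functional R 4) (p q phi varphi : R * R -> R) : Prop :=
  forall x t : R,
    col4 (partial2 p (x, t)) (partial2 q (x, t))
         (partial2 phi (x, t)) (partial2 varphi (x, t))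
    = J *m variational_derivative H
        (fun y => col4 (p (y, t)) (q (y, t)) (phi (y, t)) (varphi (y, t))) x.

(* Main.v *)
Require Import Defs.
From mathcomp Require Import all_boot all_order all_algebra.
From mathcomp Require Import all_classical all_reals all_analysis.
From mathcomp Require Import complex.
From mathcomp Require Import ring lra.

Import Order.TTheory GRing.Theory Num.Theory.
Import numFieldNormedType.Exports.

Local Open Scope ring_scope.

(** Separating real and imaginary parts, the Schroedinger equation for
    u = p + iq with u_t = phi + i varphi reads
      kappa phi_t - varphi + beta p_xx + V_p = 0,
      kappa varphi_t + phi + beta q_xx + V_q = 0
    ([solves_nnls_cartesian]). The Euler operator turns the density of H into
      (- V_p - beta p_xx, - V_q - beta q_xx, - kappa phi, - kappa varphi)
    ([variational_derivative_hamiltonian]). Multiplication by J(kappa) therefore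
    makes the first two rows of the Hamiltonian system say p_t = phi and
    q_t = varphi, and the last two, once multiplied by kappa, are the two
    equations above ([Jmat_mul_eq], [solves_hamiltonian_cartesian]).

    Every derivative that occurs is a directional one, so two chain rules are
    enough: one for an affine inner map, under which the difference quotients
    are literally the same, and one for a continuous linear outer map. The
    first handles slices y |-> (y, t), coordinates of columns and the term
    V (w_0, w_1); the second handles real and imaginary parts. *)

(** * Chain rules for directional derivatives *)

(** An affine map sends the line through [a] with direction [v] to the line
    through [A a] with direction [w], at the same speed, so the two difference
    quotients coincide. *)
Lemma is_derive_comp_affine (R : realType) (U U' W : normedModType R)
    (A : U -> U') (g : U' -> W) (a v : U) (w : U') (dg : W) :
  (forall h : R, A (h *: v + a) = h *: w + A a) ->
  is_derive (A a) w g dg -> is_derive a v (g \o A) dg.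
Proof.
move=> affA [gD gE].
have E : (fun h : R => h^-1 *: (((g \o A) \o shift a) (h *: v) - (g \o A) a))
    = (fun h : R => h^-1 *: ((g \o shift (A a)) (h *: w) - g (A a))).
  by apply/funext => h /=; rewrite affA.
by split; [rewrite /derivable E|rewrite /derive E].
Qed.

Lemma is_derive_coord (R : realType) (n : nat) (a v : 'cV[R]_n.+1)
    (i : 'I_n.+1) :
  is_derive a v (fun b : 'cV[R]_n.+1 => b i 0) (v i 0).
Proof.
apply: (@is_derive_comp_affine R _ _ _ (fun b : 'cV[R]_n.+1 => b i 0) id).
by move=> h; rewrite !mxE.
Qed.

Lemma is_derive_linear_comp (R : realType) (U W W' : normedModType R)
    (L : {linear W -> W'}) (f : U -> W) (a v : U) :
  continuous L -> derivable f a v -> is_derive a v (L \o f) (L ('D_v f a)).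
Proof.
move=> contL fD.
have E : (fun h : R => h^-1 *: (((L \o f) \o shift a) (h *: v) - (L \o f) a))
    = L \o (fun h : R => h^-1 *: ((f \o shift a) (h *: v) - f a)).
  apply/funext => h /=; rewrite [RHS]linearZ_LR; congr (_ *: _).
  by rewrite linearB.
have C : ((fun h : R => h^-1 *: (((L \o f) \o shift a) (h *: v) - (L \o f) a))
    @ 0^' --> L ('D_v f a))%classic.
  by rewrite E; apply: continuous_cvg; [exact: contL|exact: fD].
by split; [apply/cvg_ex; exists (L ('D_v f a))|apply: cvg_lim].
Qed.

(** * Real and imaginary parts of a complex-valued field *)

Lemma nonexpansive_linear_continuous (R : realType) (W W' : normedModType R)
    (L : {linear W -> W'}) :
  (forall w, `|L w| <= `|w|) -> continuous L.
Proof.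
move=> leL; apply: bounded_linear_continuous.
apply/linear_boundedP; near=> k => w.
apply: le_trans (leL w) _; rewrite ler_peMl //; near: k.
Unshelve. all: by end_near. Qed.

Lemma Re_continuous (R : realType) :
  continuous (@complex.Re R : Rcomplex R -> R).
Proof.
apply: nonexpansive_linear_continuous => -[a b]; rewrite [leRHS]/Num.norm /=.
by rewrite -sqrtr_sqr; apply: ler_wsqrtr; rewrite lerDl sqr_ge0.
Qed.

Lemma Im_continuous (R : realType) :
  continuous (@complex.Im R : Rcomplex R -> R).
Proof.
apply: nonexpansive_linear_continuous => -[a b]; rewrite [leRHS]/Num.norm /=.
by rewrite -sqrtr_sqr; apply: ler_wsqrtr; rewrite lerDr sqr_ge0.
Qed.

Lemma is_derive_cartesian (R : realType) (U : normedModType R)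
    (u : U -> Rcomplex R) (p q : U -> R) (z v : U) :
  (forall z, u z = (p z +i* q z)%C) -> derivable u z v ->
  is_derive z v p (complex.Re ('D_v u z)) /\
  is_derive z v q (complex.Im ('D_v u z)).
Proof.
move=> uE uD; split.
  have -> : p = (@complex.Re R : Rcomplex R -> R) \o u.
    by apply/funext => y /=; rewrite uE.
  exact: is_derive_linear_comp _ _ _ _ _ _ _ _ (@Re_continuous R) uD.
have -> : q = (@complex.Im R : Rcomplex R -> R) \o u.
  by apply/funext => y /=; rewrite uE.
exact: is_derive_linear_comp _ _ _ _ _ _ _ _ (@Im_continuous R) uD.
Qed.

Lemma derive_cartesian (R : realType) (U : normedModType R)
    (u : U -> Rcomplex R) (p q : U -> R) (v : U) :
  (forall z, u z = (p z +i* q z)%C) -> (forall z, derivable u z v) ->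
  forall z, 'D_v u z = ('D_v p z +i* 'D_v q z)%C.
Proof.
move=> uE uD z; have [dp dq] := is_derive_cartesian _ _ _ _ _ _ _ uE (uD z).
rewrite (@derive_val _ _ _ _ _ _ _ dp) (@derive_val _ _ _ _ _ _ _ dq).
by case: ('D_v u z).
Qed.

(** * The variational derivative of the Hamiltonian *)

Lemma is_derive_slice1 (R : realType) (g : R * R -> R) (x t : R) :
  derivable g (x, t) (1, 0) ->
  is_derive x 1 (fun y => g (y, t)) (partial1 g (x, t)).
Proof.
move=> gD.
apply: (@is_derive_comp_affine R _ _ _ (fun y : R => (y, t)) g x 1 (1, 0)).
  by move=> h; congr (_, _) => /=; rewrite scaler0 add0r.
exact: derivableP.
Qed.

(** The direction [v] stays arbitrary so that one computation serves all four
    components of the Euler operator. *)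
Lemma is_derive_density_gradient (R : realType) (kappa beta : R)
    (V : R * R -> R) (a b v : 'cV[R]_4) :
  is_derive b v (fun b => density (hamiltonian kappa beta V) a b)
    (beta * (v 0 0 * b 0 0 + v 1 0 * b 1 0)).
Proof.
have co := is_derive_coord R 3 b v.
have := is_deriveB (is_deriveB (is_deriveZ (beta / 2)
  (is_deriveD (is_deriveX 2 (co 0)) (is_deriveX 2 (co 1))))
  (is_derive_cst (V (a 0 0, a 1 0)) b v))
  (is_derive_cst (kappa / 2 * (a 2 0 ^+ 2 + a 3 0 ^+ 2)) b v).
move/is_derive_eq; apply.
rewrite /GRing.scale /= !expr1; lra.
Qed.

(** The potential term is [V] composed with the linear map that keeps the first
    two coordinates, hence the direction in which [V] is differentiated. *)
Lemma is_derive_density_field (R : realType) (kappa beta : R)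
    (V : R * R -> R) (a b v : 'cV[R]_4) :
  derivable V (a 0 0, a 1 0) (v 0 0, v 1 0) ->
  is_derive a v (fun a => density (hamiltonian kappa beta V) a b)
    (- 'D_((v 0 0, v 1 0) : R * R) V (a 0 0, a 1 0)
     - kappa * (a 2 0 * v 2 0 + a 3 0 * v 3 0)).
Proof.
move=> VD.
have co := is_derive_coord R 3 a v.
have dV : is_derive a v (fun a : 'cV[R]_4 => V (a 0 0, a 1 0))
    ('D_((v 0 0, v 1 0) : R * R) V (a 0 0, a 1 0)).
  apply: (@is_derive_comp_affine R _ _ _
    (fun a : 'cV[R]_4 => (a 0 0, a 1 0)) V a v (v 0 0, v 1 0)).
    by move=> h; rewrite !mxE.
  exact: derivableP.
have := is_deriveB (is_deriveB
  (is_derive_cst (beta / 2 * (b 0 0 ^+ 2 + b 1 0 ^+ 2)) a v) dV)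
  (is_deriveZ (kappa / 2)
    (is_deriveD (is_deriveX 2 (co 2)) (is_deriveX 2 (co 3)))).
move/is_derive_eq; apply.
rewrite /GRing.scale /= !expr1; lra.
Qed.

(** In direction [delta_mx i 0], [V] and the term in [w_x] contribute only to the
    first two components, and the term in [phi] and [varphi] only to the last
    two. *)
Lemma variational_derivative_hamiltonian (R : realType) (kappa beta : R)
    (V : R * R -> R) (p q phi varphi : R -> R) (x : R) :
  (forall z v, derivable V z v) ->
  derivable (derive1 p) x 1 -> derivable (derive1 q) x 1 ->
  variational_derivative (hamiltonian kappa beta V)
    (fun y => col4 (p y) (q y) (phi y) (varphi y)) x =
  col4 (- partial1 V (p x, q x) - beta * derive1 (derive1 p) x)
       (- partial2 V (p x, q x) - beta * derive1 (derive1 q) x)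
       (- (kappa * phi x)) (- (kappa * varphi x)).
Proof.
move=> VD pD qD; set w := fun y => _.
have wx0 y : field_x w y 0 0 = derive1 p y.
  by rewrite mxE; congr (derive1 _ _); apply/funext => s; rewrite mxE.
have wx1 y : field_x w y 1 0 = derive1 q y.
  by rewrite mxE; congr (derive1 _ _); apply/funext => s; rewrite mxE.
have Lw := is_derive_density_field R kappa beta V (w x) (field_x w x) _
  (VD _ _).
have Lwx := fun y => is_derive_density_gradient R kappa beta V (w y)
  (field_x w y).
apply/colP => i; rewrite [LHS]mxE (@derive_val _ _ _ _ _ _ _ (Lw _)).
under [X in derive1 X]eq_fun do
  rewrite (@derive_val _ _ _ _ _ _ _ (Lwx _ _)) wx0 wx1.
rewrite derive1E.
have dpq (c d : R) :
    is_derive x 1 (fun y => beta * (c * derive1 p y + d * derive1 q y))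
      (beta * (c * derive1 (derive1 p) x + d * derive1 (derive1 q) x)).
  rewrite [derive1 (derive1 p) x]derive1E [derive1 (derive1 q) x]derive1E.
  exact: (is_deriveZ beta (is_deriveD
    (is_deriveZ c (derivableP pD)) (is_deriveZ d (derivableP qD)))).
(* The numerals 0 and 1 are the coordinates of [delta_mx i 0]. Stating these
   identities over variables keeps conversion from unfolding the derivatives. *)
have alg0 (A B C P Q : R) :
    - A - kappa * (B * 0 + C * 0) - beta * (1 * P + 0 * Q) = - A - beta * P.
  by ring.
have alg1 (A B C P Q : R) :
    - A - kappa * (B * 0 + C * 0) - beta * (0 * P + 1 * Q) = - A - beta * Q.
  by ring.
have alg2 (B C P Q : R) :
    - 0 - kappa * (B * 1 + C * 0) - beta * (0 * P + 0 * Q) = - (kappa * B).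
  by ring.
have alg3 (B C P Q : R) :
    - 0 - kappa * (B * 0 + C * 1) - beta * (0 * P + 0 * Q) = - (kappa * C).
  by ring.
rewrite (@derive_val _ _ _ _ _ _ _ (dpq _ _)) !mxE.
case: i => [[|[|[|[|//]]]] i4] /=.
- exact: alg0.
- exact: alg1.
- by rewrite derive0; exact: alg2.
- by rewrite derive0; exact: alg3.
Qed.

(** * The two equations in real form *)

Lemma nnls_cartesian (R : realType) (kappa beta : R)
    (ptt qtt pt qt pxx qxx m n : R) :
  kappa *: ((ptt +i* qtt)%C : Rcomplex R)
    + ('i%C : Rcomplex R) * ((pt +i* qt)%C : Rcomplex R)
    + beta *: ((pxx +i* qxx)%C : Rcomplex R) + ((m +i* n)%C : Rcomplex R)
  = ((kappa * ptt - qt + beta * pxx + m)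
     +i* (kappa * qtt + pt + beta * qxx + n))%C.
Proof.
have iE : ('i%C : Rcomplex R) * ((pt +i* qt)%C : Rcomplex R)
    = ((- qt) +i* pt)%C :> Rcomplex R.
  by congr (_ +i* _)%C; ring.
by rewrite iE.
Qed.

(** The entries 1/kappa^2 of [Jmat] meet - kappa phi and - kappa varphi and give
    the terms phi / kappa and varphi / kappa, so multiplying the last two rows
    by kappa clears all denominators. *)
Lemma Jmat_mul_eq (R : realType) (kappa : R)
    (pt qt phit varphit P Q phi varphi : R) :
  kappa != 0 ->
  col4 pt qt phit varphit
    = Jmat kappa *m col4 P Q (- (kappa * phi)) (- (kappa * varphi)) <->
  [/\ pt = phi, qt = varphi, kappa * phit - varphi = P
    & kappa * varphit + phi = Q].
Proof.
move=> k0; split=> [H|[-> -> <- <-]].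
  have {}H i := congr1 (fun M : 'cV_4 => M i 0) H.
  have := (H 0, H 1, H 2, H 3).
  rewrite !mxE !big_ord_recr !big_ord0 /= !mxE /=.
  by move=> [[[-> ->] ->] ->]; split; field.
apply/colP => i; rewrite !mxE !big_ord_recr !big_ord0 /= !mxE.
by case: i => [[|[|[|[|//]]]] i4] /=; field.
Qed.

Lemma smooth_cartesian (R : realType) (u : R * R -> Rcomplex R)
    (p q : R * R -> R) :
  smooth u -> (forall z, u z = (p z +i* q z)%C) ->
  (forall v z, 'D_v u z = ('D_v p z +i* 'D_v q z)%C) /\
  (forall v w z, 'D_w ('D_v u) z = ('D_w ('D_v p) z +i* 'D_w ('D_v q) z)%C).
Proof.
move=> u_smooth uE.
have D1u z v : derivable u z v by have [_] := u_smooth [::]; apply.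
have D2u w z v : derivable ('D_w u) z v.
  by have [_] := u_smooth [:: w]; apply.
have dE v := derive_cartesian _ _ _ _ _ v uE (fun z => D1u z v).
split=> // v w z.
exact: derive_cartesian _ _ _ _ _ w (dE v) (fun z => D2u v z w) z.
Qed.

Lemma smooth_cartesian_derivable1 (R : realType) (u : R * R -> Rcomplex R)
    (p q : R * R -> R) :
  smooth u -> (forall z, u z = (p z +i* q z)%C) ->
  (forall z, derivable p z (1, 0) /\ derivable q z (1, 0)) /\
  (forall z, derivable (partial1 p) z (1, 0) /\
             derivable (partial1 q) z (1, 0)).
Proof.
move=> u_smooth uE; have [dE _] := smooth_cartesian R u p q u_smooth uE.
split=> z.
  have uD : derivable u z (1, 0) by have [_] := u_smooth [::]; apply.
  by have [[? _] [? _]] := is_derive_cartesian _ _ _ _ _ z (1, 0) uE uD.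
have uD : derivable (partial1 u) z (1, 0).
  by have [_] := u_smooth [:: (1, 0)]; apply.
by have [[dp _] [dq _]] := is_derive_cartesian _ _ (partial1 u) (partial1 p)
  (partial1 q) z (1, 0) (dE (1, 0)) uD.
Qed.

Lemma solves_nnls_cartesian (R : realType) (kappa beta : R) (V : R * R -> R)
    (f : Rcomplex R -> Rcomplex R) (u : R * R -> Rcomplex R)
    (p q : R * R -> R) :
  (forall p q : R, complex.Re (f (p +i* q)%C) = partial1 V (p, q)) ->
  (forall p q : R, complex.Im (f (p +i* q)%C) = partial2 V (p, q)) ->
  smooth u -> (forall z, u z = (p z +i* q z)%C) ->
  solves_nnls kappa beta f u <-> forall z,
    kappa * partial2 (partial2 p) z - partial2 q z
      + beta * partial1 (partial1 p) z + partial1 V (p z, q z) = 0 /\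
    kappa * partial2 (partial2 q) z + partial2 p z
      + beta * partial1 (partial1 q) z + partial2 V (p z, q z) = 0.
Proof.
move=> Re_f Im_f u_smooth uE.
have [dE ddE] := smooth_cartesian R u p q u_smooth uE.
have fE z : f (u z) = (partial1 V (p z, q z) +i* partial2 V (p z, q z))%C.
  by rewrite uE -Re_f -Im_f; case: (f _).
have E z : kappa *: partial2 (partial2 u) z
    + ('i%C : Rcomplex R) * partial2 u z
    + beta *: partial1 (partial1 u) z + f (u z)
  = ((kappa * partial2 (partial2 p) z - partial2 q z
        + beta * partial1 (partial1 p) z + partial1 V (p z, q z))
     +i* (kappa * partial2 (partial2 q) z + partial2 p z
        + beta * partial1 (partial1 q) z + partial2 V (p z, q z)))%C.
  rewrite fE [partial2 (partial2 u) z]ddE [partial2 u z]dE.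
  rewrite [partial1 (partial1 u) z]ddE.
  exact: nnls_cartesian.
have C0 : ((0 : R) +i* 0)%C = 0 :> Rcomplex R by [].
split=> H z; first by have := H z; rewrite E => -[].
have [h1 h2] := H z; rewrite E.
exact: (etrans (f_equal2 (@Complex R) h1 h2) C0).
Qed.

Lemma solves_hamiltonian_cartesian (R : realType) (kappa beta : R)
    (V : R * R -> R) (p q phi varphi : R * R -> R) :
  kappa != 0 -> (forall z v, derivable V z v) ->
  (forall z, derivable p z (1, 0) /\ derivable q z (1, 0)) ->
  (forall z, derivable (partial1 p) z (1, 0) /\
             derivable (partial1 q) z (1, 0)) ->
  solves_hamiltonian_system (Jmat kappa) (hamiltonian kappa beta V)
    p q phi varphi <-> forall z,
  [/\ partial2 p z = phi z, partial2 q z = varphi z,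
    kappa * partial2 phi z - varphi z
      + beta * partial1 (partial1 p) z + partial1 V (p z, q z) = 0 &
    kappa * partial2 varphi z + phi z
      + beta * partial1 (partial1 q) z + partial2 V (p z, q z) = 0].
Proof.
move=> k0 VD pq1 pq11.
have slice (g : R * R -> R) (gD : forall z, derivable g z (1, 0)) x t :
    derive1 (fun y => g (y, t)) x = partial1 g (x, t).
  by rewrite derive1E; have [_ ->] := is_derive_slice1 _ _ _ _ (gD (x, t)).
have p1 t : derive1 (fun y => p (y, t)) = fun y => partial1 p (y, t).
  by apply/funext => y; apply: slice => z; case: (pq1 z).
have q1 t : derive1 (fun y => q (y, t)) = fun y => partial1 q (y, t).
  by apply/funext => y; apply: slice => z; case: (pq1 z).
have EL x t : variational_derivative (hamiltonian kappa beta V)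
    (fun y => col4 (p (y, t)) (q (y, t)) (phi (y, t)) (varphi (y, t))) x =
  col4 (- partial1 V (p (x, t), q (x, t)) - beta * partial1 (partial1 p) (x, t))
       (- partial2 V (p (x, t), q (x, t)) - beta * partial1 (partial1 q) (x, t))
       (- (kappa * phi (x, t))) (- (kappa * varphi (x, t))).
  have [dp dq] := pq11 (x, t).
  have := variational_derivative_hamiltonian R kappa beta V
    (fun y => p (y, t)) (fun y => q (y, t)) (fun y => phi (y, t))
    (fun y => varphi (y, t)) x VD.
  rewrite p1 q1 !slice; last 2 first.
  - by move=> z; case: (pq11 z).
  - by move=> z; case: (pq11 z).
  by apply; [have [] := is_derive_slice1 _ _ _ _ dp
            |have [] := is_derive_slice1 _ _ _ _ dq].
have move_right (a b c : R) : a = - c - b <-> a + b + c = 0.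
  by split=> [->|/eqP]; [ring|rewrite !addr_eq0 => /eqP <-; ring].
split=> H.
  move=> [x t]; have := H x t.
  rewrite EL => /(Jmat_mul_eq _ _ _ _ _ _ _ _ _ _ k0).
  by case=> h1 h2 /move_right h3 /move_right h4; split.
move=> x t; rewrite EL; apply/(Jmat_mul_eq _ _ _ _ _ _ _ _ _ _ k0).
have [h1 h2 /move_right h3 /move_right h4] := H (x, t); split.
- exact: h1.
- exact: h2.
- exact: h3.
- exact: h4.
Qed.

Theorem mainTheorem1 (R : realType) (kappa beta : R) (V : R * R -> R)
    (f : Rcomplex R -> Rcomplex R)
    (kappa_gt0 : 0 < kappa) (beta_gt0 : 0 < beta) (V_smooth : smooth V)
    (Re_f : forall p q : R, complex.Re (f (p +i* q)%C) = partial1 V (p, q))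
    (Im_f : forall p q : R, complex.Im (f (p +i* q)%C) = partial2 V (p, q)) :
  (Jmat kappa)^T = - Jmat kappa /\
  forall (u : R * R -> Rcomplex R) (p q phi varphi : R * R -> R),
    smooth u ->
    (forall z, u z = (p z +i* q z)%C) ->
    ((forall z, partial2 u z = (phi z +i* varphi z)%C) /\
     solves_nnls kappa beta f u
     <->
     solves_hamiltonian_system (Jmat kappa) (hamiltonian kappa beta V)
       p q phi varphi).
Proof.
split.
  apply/matrixP => i j; rewrite !mxE.
  by case: i => [[|[|[|[|//]]]] i4]; case: j => [[|[|[|[|//]]]] j4] /=;
    rewrite ?opprK ?oppr0.
move=> u p q phi varphi u_smooth uE.
have k0 : kappa != 0 by rewrite gt_eqF.
have VD z v : derivable V z v by have [_] := V_smooth [::]; apply.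
have [dE _] := smooth_cartesian R u p q u_smooth uE.
have u_t z : partial2 u z = (partial2 p z +i* partial2 q z)%C by exact: dE.
have [pq1 pq11] := smooth_cartesian_derivable1 R u p q u_smooth uE.
rewrite (solves_nnls_cartesian R kappa beta V f u p q) //.
rewrite (solves_hamiltonian_cartesian R kappa beta V p q phi varphi) //.
(* Either side forces [phi] and [varphi] to be the t-derivatives of [p] and [q],
   and the remaining equations then agree term by term. *)
split=> [[u2 nls] z|ham].
  have pE : phi = partial2 p.
    by apply/funext => y; have := u2 y; rewrite u_t => -[].
  have qE : varphi = partial2 q.
    by apply/funext => y; have := u2 y; rewrite u_t => -[].
  by have [? ?] := nls z; rewrite pE qE.
have pE : phi = partial2 p by apply/funext => z; case: (ham z).
have qE : varphi = partial2 q by apply/funext => z; case: (ham z).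
by split=> z; case: (ham z); rewrite pE qE // u_t.
Qed.
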